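(* Let $v_1,\ldots,v_d\in\mathbb{Z}^n$ be linearly independent, $n\geq d$. Then $$\operatorname{relint}\big(\operatorname{cone}_{\mathbb{R}}(v_1,\ldots,v_d)\big)\cap\mathbb{Z}^n=\bigcup_{z\ \text{atomic}}\Big(z+\operatorname{cone}_{\mathbb{Z}}(v_1,\ldots,v_{\operatorname{lev}(z)})\Big),$$ where the union ranges over all atomic lattice points $z$ (with respect to the ordered generators $v_1,\ldots,v_d$) in the half-open fundamental simplex of $\operatorname{cone}_{\mathbb{R}}(v_1,\ldots,v_d)$, and the sets in this union are pairwise disjoint.
   Context: $\operatorname{cone}_{\mathbb{R}}(v_1,\ldots,v_d)$ is the set of non-negative real linear combinations of the $v_i$ and $\operatorname{cone}_{\mathbb{Z}}(v_1,\ldots,v_s)$ the set of non-negative integer combinations of $v_1,\ldots,v_s$; $\operatorname{relint}$ denotes relative interior (interior within the linear span). The half-open fundamental simplex is $\Delta^\circ(v_1,\ldots,v_d)=\{\sum_{i=1}^d\lambda_i v_i : \lambda_i>0,\ \sum_i\lambda_i\leq d\}$. A point $z=\sum_i\lambda_iv_i$ of the cone with $\sum_i\lambda_i>0$ is at level $\operatorname{lev}(z)=k$, where $k$ is the integer with $k-1<\sum_i\lambda_i\leq k$. Let $\operatorname{Lev}(k)$ be the set of points of $\mathbb{Z}^n\cap\Delta^\circ(v_1,\ldots,v_d)$ at level $k$. Define inductively $T_1=\operatorname{Lev}(1)$ and, for $k=2,\ldots,d$, $T_k=\operatorname{Lev}(k)\setminus\bigcup_{i=1}^{k-1}\bigcup_{z\in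 T_i}\big(z+\operatorname{cone}_{\mathbb{Z}}(v_1,\ldots,v_i)\big)$. The atomic lattice points are the elements of $T_1\cup\cdots\cup T_d$. *)

(* Defs.v *)
From HB Require Import structures.
From mathcomp Require Export all_boot all_order all_algebra.
From mathcomp Require Export all_classical all_reals all_analysis.

Set Implicit Arguments.
Unset Strict Implicit.
Unset Printing Implicit Defensive.

Import Order.TTheory GRing.Theory Num.Theory.
Import numFieldNormedType.Exports.

Local Open Scope classical_set_scope.
Local Open Scope ring_scope.

Section RelativeInterior.
Variables (R : realType) (n : nat).
Implicit Types A : set 'rV[R]_n.

Definition linear_span A : set 'rV[R]_n :=
  [set x | exists2 s : seq 'rV[R]_n, (forall y, y \in s -> A y)
                                   & x \in span s].

Definition relint A : set 'rV[R]_n :=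
  @interior (subspace (linear_span A)) A.

Lemma sub_linear_span A : A `<=` linear_span A.
Proof.
move=> x Ax; exists [:: x]; first by move=> y; rewrite inE => /eqP ->.
by rewrite memv_span ?mem_head.
Qed.

(* Sanity check: outside the span, the library's [subspace] topology is
   discrete; this adds no point to [relint A] as [A] lies in its span. *)
Lemma relintP A x :
  relint A x <-> A x /\ \forall y \near within (linear_span A) (nbhs x), A y.
Proof.
rewrite /relint; split=> [xA|[Ax]].
  have Ax : A x := interior_subset xA.
  by split=> //; rewrite nbhs_subspace_in //; exact: sub_linear_span.
by rewrite nbhs_subspace_in //; exact: sub_linear_span.
Qed.

End RelativeInterior.

Section AtomicPoints.
Variables (R : realType) (n d : nat).
Implicit Types (v : 'I_d -> 'rV[R]_n) (z : 'rV[R]_n) (k : nat).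

Definition Zlattice : set 'rV[R]_n := [set x | x \is a mxOver Num.int].

Definition coneR v : set 'rV[R]_n :=
  [set x | exists2 a : 'I_d -> R, (forall i, 0 <= a i)
                                & x = \sum_(i < d) a i *: v i].

(* Indices start at 0: [coneZ v s] is generated by the first s vectors. *)
Definition coneZ v (s : nat) : set 'rV[R]_n :=
  [set x | exists a : 'I_d -> nat, x = \sum_(i < d | (i < s)%N) v i *+ a i].

Definition half_open_simplex v : set 'rV[R]_n :=
  [set x | exists a : 'I_d -> R, [/\ forall i, 0 < a i,
    \sum_(i < d) a i <= d%:R & x = \sum_(i < d) a i *: v i]].

Definition at_level v z k : Prop :=
  exists a : 'I_d -> R, [/\ forall i, 0 <= a i, 0 < \sum_(i < d) a i,
    z = \sum_(i < d) a i *: v i & k%:R - 1 < \sum_(i < d) a i <= k%:R].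

(* The level is unique when v is linearly independent; 0 is a junk value for
   points that have no level. *)
Definition lev v z : nat := xget 0%N [set k | at_level v z k].

Definition Lev v k : set 'rV[R]_n :=
  [set z | [/\ Zlattice z, half_open_simplex v z & at_level v z k]].

Definition translated_cone v z k : set 'rV[R]_n :=
  [set z + w | w in coneZ v k].

(* [covered v k] accumulates the cones attached to T_1, ..., T_k, so that the
   course-of-values recursion for T becomes structural; see [TsetE]. *)
Fixpoint covered v k : set 'rV[R]_n :=
  if k is k'.+1 then
    covered v k' `|`
    \bigcup_(z in Lev v k `\` covered v k') translated_cone v z k
  else set0.

Definition Tset v k : set 'rV[R]_n := Lev v k `\` covered v k.-1.

Lemma TsetE v k : Tset v k = Lev v k `\`
  \bigcup_(i in [set i | (1 <= i < k)%N])
    \bigcup_(z in Tset v i) translated_cone v z i.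
Proof.
rewrite /Tset; congr (_ `\` _); case: k => [|k] /=.
  by rewrite predeqE => x; split=> // -[i /=]; rewrite ltn0 andbF.
elim: k => [|k IHk] /=.
  by rewrite predeqE => x; split=> // -[[|i]].
rewrite {1}IHk predeqE => x; split.
  case=> [[i /= /andP[i0 ik] xi]|xk]; last by exists k.+1 => //=.
  by exists i => //=; rewrite i0 ltnW.
case=> i /= /andP[i0]; rewrite ltnS leq_eqVlt => /predU1P[->|ik] xi.
  by right.
by left; exists i => //=; rewrite i0.
Qed.

Definition atomic v : set 'rV[R]_n :=
  \bigcup_(k in [set k | (1 <= k <= d)%N]) Tset v k.

End AtomicPoints.

Arguments Zlattice {R n}.

(* Main.v *)
(** In the coordinates a of a lattice point z with respect to v, the set T_k
    consists exactly of the z at level k with all a_i > 0 and a_i <= 1 for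
    the first k - 1 indices i; call these points
    reduced. The relative interior of the cone is the set a > 0, so it suffices
    that every lattice point x with positive coordinates is uniquely z + w with
    z reduced at level k and w in coneZ v k.
    Existence: take the least k such that reducing the first k coordinates of x
    to ]0, 1] brings the coordinate sum down to at most k, then add back the
    right number of copies of the k-th generator.
    Uniqueness: if z + w = y + u with levels k < l, then the coordinates of y
    are at most those of z, which contradicts k < l; if k = l, the coordinates
    below the last generator agree as they lie in ]0, 1] and are congruent
    modulo 1, those above it agree, and the level fixes the remaining one.
    The description of T_k follows by induction on k. *)

Require Import Defs.
From mathcomp Require Import lra.

Set Implicit Arguments.
Unset Strict Implicit.
Unset Printing Implicit Defensive.

Import Order.TTheory GRing.Theory Num.Theory.
Import numFieldNormedType.Exports.
Local Open Scope classical_set_scope.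
Local Open Scope ring_scope.

(* Ordinals are 0-based: the last clause concerns the first k - 1 indices. *)
Definition reduced (R : realType) (d k : nat) (a : 'I_d -> R) : Prop :=
  [/\ forall i, 0 < a i, k%:R - 1 < \sum_i a i <= k%:R
    & forall i : 'I_d, (i.+1 < k)%N -> a i <= 1].

(** * Reduction of positive real coordinate vectors *)

Lemma positive_frac_part (R : realType) (x : R) :
  0 < x -> exists m : nat, 0 < x - m%:R <= 1.
Proof.
(* The target ]0, 1] is closed on the right, so [m] is the ceiling minus one, not the floor. *)
move=> x0; have := ceil_itv x; have : 0 < Num.ceil x by rewrite ceil_gt0.
case: (Num.ceil x) => [[|m]|] // _.
rewrite intrB -pmulrn -natr1 => /andP[h1 h2]; exists m; apply/andP; split; lra.
Qed.

(** Turns comparisons of naturals into strict real inequalities that [lra] can settle. *)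
Lemma ltr_natD1 (R : realType) (m n : nat) :
  (m%:R < n%:R + 1 :> R) = (m <= n)%N.
Proof. by rewrite natr1 ltr_nat ltnS. Qed.

Lemma level_unique (R : realType) (x : R) (k l : nat) :
  k%:R - 1 < x <= k%:R -> l%:R - 1 < x <= l%:R -> k = l.
Proof.
move=> /andP[k1 k2] /andP[l1 l2].
by apply/eqP; rewrite eqn_leq -!(@ltr_natD1 R); apply/andP; split; lra.
Qed.

Lemma reduced_exists (R : realType) (d : nat) (a : 'I_d -> R) :
  (0 < d)%N -> (forall i, 0 < a i) ->
  exists k (w : 'I_d -> nat), [/\ (0 < k <= d)%N,
    forall i : 'I_d, (k <= i)%N -> w i = 0%N & reduced k (fun i => a i - (w i)%:R)].
Proof.
move=> d0 a0.
have /choice[m mP] i := positive_frac_part (a0 i).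
(* Coordinate sum once the first [k] coordinates are reduced to ]0, 1]. *)
pose s k := \sum_i (a i - (if (i < k)%N then (m i)%:R else 0)).
have sd : s d <= d%:R.
  rewrite -[d in d%:R]card_ord -sum1_card natr_sum; apply: ler_sum => i _.
  by rewrite ltn_ord; case/andP: (mP i).
have [|k sk kmin] := @ex_minnP (fun k => s k <= k%:R); first by exists d.
have kd : (k <= d)%N by exact: kmin.
case: k => [|k] in sk kd kmin *.
  have : 0 < s 0%N.
    rewrite /s (bigD1 (Ordinal d0)) //= subr0 ltr_pwDl // sumr_ge0 // => i _.
    by rewrite subr0 ltW.
  by rewrite ltNge sk.
have skk : k%:R < s k by rewrite ltNge; apply/negP => /kmin; rewrite ltnn.
pose j := Ordinal kd.
have sE : s k = s k.+1 + (m j)%:R.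
  rewrite /s (bigD1 j) //= [in RHS](bigD1 j) //= ltnn ltnSn subr0.
  rewrite addrAC subrK; congr (_ + _); apply: eq_bigr => i ij.
  by rewrite [(i < k.+1)%N]ltnS [(i <= k)%N]leq_eqVlt (negbTE (ij : (i : nat) != k)).
(* Copies of generator [j] to add back: the largest number keeping the sum at most [k.+1], which
   also pushes it above [k]. *)
pose t := Num.truncn (k.+1%:R - s k.+1).
have /andP[t1 t2] : t%:R <= k.+1%:R - s k.+1 < t.+1%:R.
  by apply: truncn_itv; rewrite subr_ge0.
(* Follows from [k < s k = s k.+1 + m j]; it keeps the natural subtraction [m j - t] from
   truncating. *)
have tm : (t <= m j)%N.
  rewrite -(@ltr_natD1 R); move: t1; rewrite -natr1 => t1; lra.
exists k.+1, (fun i => if i == j then m j - t else if (i < k)%N then m i else 0)%N.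
split => //.
  move=> i ki; have -> : (i == j) = false by apply/eqP => ij; rewrite ij ltnn in ki.
  by rewrite ltnNge ltnW.
split=> [i||i]; last first.
- rewrite ltnS => ik; rewrite ik; case: eqP => [ij|_]; first by rewrite ij ltnn in ik.
  by case/andP: (mP i).
- rewrite (_ : \sum_i _ = s k.+1 + t%:R).
    by move: t1 t2; rewrite -!natr1 => t1 t2; apply/andP; split; lra.
  rewrite /s (bigD1 j) //= [in RHS](bigD1 j) //= eqxx ltnSn natrB // opprB.
  rewrite [RHS]addrAC; congr (_ + _); first by rewrite addrA addrAC.
  apply: eq_bigr => i ij; rewrite (negbTE ij) ltnS [(i <= k)%N]leq_eqVlt.
  by rewrite (negbTE (ij : (i : nat) != k)) /=; case: ifP.
- have /andP[mi _] := mP i; case: eqP => [->|_].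
    by have /andP[mj _] := mP j; rewrite natrB //; have := ler0n R t; lra.
  by case: ifP; rewrite ?subr0.
Qed.

Lemma reduced_le (R : realType) (d k l : nat) (a b : 'I_d -> R)
    (w u : 'I_d -> nat) : reduced k a -> reduced l b ->
  (forall i : 'I_d, (k <= i)%N -> w i = 0%N) ->
  (forall i, a i + (w i)%:R = b i + (u i)%:R) -> (l <= k)%N.
Proof.
move=> [a0 /andP[a1 a2] a3] [b0 /andP[b1 b2] b3] w0 e.
rewrite leqNgt; apply/negP => kl.
suff ba : \sum_i b i <= \sum_i a i.
  by move: kl; rewrite ltnNge -(@ltr_natD1 R) => /negP; apply; lra.
(* For [i >= k], [w i = 0] gives [b i <= a i]. For [i < k < l], [b i <= 1] and [0 < a i] force
   [w i < u i + 1], so again [b i <= a i]. *)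
apply: ler_sum => i _; have ei := e i.
have [ki|ik] := leqP k i; first by move: ei; rewrite (w0 _ ki); have := ler0n R (u i); lra.
have wu : (w i <= u i)%N.
  by rewrite -(@ltr_natD1 R); have := a0 i; have := b3 i (leq_ltn_trans ik kl); lra.
by move: wu; rewrite -(ler_nat R); lra.
Qed.

Lemma reduced_unique (R : realType) (d k l : nat) (a b : 'I_d -> R)
    (w u : 'I_d -> nat) : reduced k a -> reduced l b ->
  (forall i : 'I_d, (k <= i)%N -> w i = 0%N) ->
  (forall i : 'I_d, (l <= i)%N -> u i = 0%N) ->
  (forall i, a i + (w i)%:R = b i + (u i)%:R) -> k = l /\ a =1 b.
Proof.
move=> ra rb w0 u0 e.
have kl : k = l.
  apply/eqP; rewrite eqn_leq (reduced_le ra rb w0 e) andbT.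
  by apply: (reduced_le rb ra u0) => i.
split=> //; subst l.
case: ra rb => [a0 /andP[a1 a2] a3] [b0 /andP[b1 b2] b3].
have wuE i : w i = u i -> a i = b i.
  by move=> wu; move: (e i); rewrite wu => /addIr.
have ab (i : 'I_d) : i.+1 != k -> a i = b i.
  rewrite neq_ltn => /orP[ik|]; last by rewrite ltnS => ik; rewrite wuE ?w0 ?u0.
  apply: wuE; apply/eqP; rewrite eqn_leq -!(@ltr_natD1 R).
  have := e i; have := a0 i; have := b0 i; have := a3 i ik; have := b3 i ik.
  by move=> ? ? ? ? ?; apply/andP; split; lra.
move=> j; have [jk|/ab //] := eqVneq j.+1 k.
have abE : \sum_(i | i != j) a i = \sum_(i | i != j) b i.
  apply: eq_bigr => i ij; apply: ab; apply: contraNneq ij.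
  by rewrite -jk => -[] /val_inj ->.
(* The two values at [j] differ by an integer and lie in a common half-open interval of length 1. *)
move: a1 a2 b1 b2; rewrite (bigD1 j) //= [in X in _ -> _ -> X](bigD1 j) //= abE.
move=> a1 a2 b1 b2; apply: wuE; apply/eqP; rewrite eqn_leq -!(@ltr_natD1 R).
by have := e j; move=> ?; apply/andP; split; lra.
Qed.

(** Padding with zero coefficients lets such sums be added coordinatewise to real combinations of
    all generators. *)
Lemma coneZP (R : realType) (n d : nat) (v : 'I_d -> 'rV[R]_n) (k : nat) x :
  coneZ v k x <-> exists2 w : 'I_d -> nat,
    (forall i : 'I_d, (k <= i)%N -> w i = 0%N)
    & x = \sum_i (w i)%:R *: v i.
Proof.
split=> [[w ->]|[w w0 ->]].
  exists (fun i : 'I_d => if (i < k)%N then w i else 0%N) => [i|].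
    by rewrite ltnNge => ->.
  rewrite big_mkcond /=; apply: eq_bigr => i _.
  by case: ifP => _; rewrite ?scale0r ?scaler_nat.
exists w; rewrite [RHS]big_mkcond /=; apply: eq_bigr => i _.
by rewrite scaler_nat; case: ltnP => // /w0 ->.
Qed.

(** * Coordinates and the relative interior of the cone *)

Section FreeGenerators.
Variables (R : realType) (n d : nat) (v : 'I_d -> 'rV[R]_n).
Hypothesis v_free : free [tuple v i | i < d].

Let crd (i : 'I_d) (x : 'rV[R]_n) : R := coord [tuple v i | i < d] i x.

Lemma coord_comb (a : 'I_d -> R) j : crd j (\sum_i a i *: v i) = a j.
Proof.
rewrite -(coord_sum_free a j v_free); congr (coord _ _ _).
by apply: eq_bigr => i _; rewrite (nth_map i) ?size_enum_ord // nth_ord_enum.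
Qed.

Lemma comb_inj (a b : 'I_d -> R) :
  \sum_i a i *: v i = \sum_i b i *: v i -> a =1 b.
Proof. by move=> ab i; rewrite -(coord_comb a) ab coord_comb. Qed.

Lemma comb_coord x : x \in span [tuple v i | i < d] ->
  x = \sum_i crd i x *: v i.
Proof.
move=> /coord_span xE; rewrite {1}xE; apply: eq_bigr => i _.
by rewrite (nth_map i) ?size_enum_ord // nth_ord_enum.
Qed.

Lemma coord_tuple_continuous i : continuous (crd i : 'rV[R]_n -> R).
Proof.
have -> : crd i = fun x : 'rV[R]_n => \sum_j x ord0 j * crd i (delta_mx ord0 j).
  apply/funext => x; rewrite {1}(row_sum_delta x) /crd linear_sum /=.
  by apply: eq_bigr => j _; rewrite linearZ.
apply: (@continuous_big R _ +%R 0) => [|j _ x].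
  exact: (@pseudometric_normed_Zmodule.add_continuous R R^o).
apply: (@continuousM R _ (fun y : 'rV[R]_n => y ord0 j) (cst _)); last exact: cst_continuous.
exact: coord_continuous.
Qed.

Lemma linear_span_coneR x :
  linear_span (coneR v) x -> x \in span [tuple v i | i < d].
Proof.
move=> [s sv]; apply: subvP; apply/span_subvP => y /sv [a _ ->].
apply: rpred_sum => i _; apply: rpredZ; apply: memv_span.
by apply/mapP; exists i; rewrite ?mem_enum.
Qed.

(** An interior [x] stays in the cone after subtracting a small positive multiple of [v i], so its
    [i]-th coordinate is positive. Conversely, finitely many continuous coordinates stay positive
    near [x]. *)
Lemma relint_coneRP x : relint (coneR v) x <->
  exists2 a : 'I_d -> R, (forall i, 0 < a i) & x = \sum_i a i *: v i.
Proof.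
split=> [/relintP[[a a0 xE] xc]|[a a0 xE]].
  exists a => // i.
  have : x - t *: v i @[t --> (0 : R)] --> x - 0 *: v i.
    by apply: cvgB; [exact: cvg_cst|exact: scalel_continuous].
  rewrite scale0r subr0 => cv.
  have /nbhs_ballP[e /= e0 he] := cv _ xc.
  have [||b b0] := he (e / 2).
  - by rewrite /ball /= sub0r normrN gtr0_norm; lra.
  (* The shifted point lies in the linear span because [x] and [v i] are in the cone. *)
  - exists [:: x; v i]; last first.
      by rewrite rpredB ?rpredZ ?memv_span ?inE ?eqxx ?orbT.
    move=> y; rewrite !inE => /orP[|] /eqP->; first by exists a.
    exists (fun j => (j == i)%:R) => [j|]; first exact: ler0n.
    rewrite (bigD1 i) //= eqxx scale1r big1 ?addr0 // => j /negPf ->.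
    by rewrite scale0r.
  move=> /(congr1 (crd i)); rewrite coord_comb {1}/crd linearB linearZ /=.
  rewrite -/(crd i x) xE coord_comb.
  have -> : coord [tuple v i  | i < d] i (v i) = 1.
    have /= := coord_comb (fun j => (j == i)%:R) i.
    rewrite eqxx (bigD1 i) //= eqxx scale1r big1 ?addr0 // => j /negPf ->.
    by rewrite scale0r.
  by have := b0 i => ?; rewrite /GRing.scale /=; lra.
apply/relintP; split; first by exists a => // i; exact: ltW.
suff : \forall y \near x, forall i, 0 < crd i y.
  apply: filterS => y y0 /linear_span_coneR/comb_coord yE.
  by exists (crd^~ y) => // i; exact: ltW.
apply: (@filter_forall _ _ (fun i y => 0 < crd i y) (nbhs x)) => i.
have xi : 0 < crd i x by rewrite xE coord_comb.
exact: (coord_tuple_continuous (lt_nbhsr xi)).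
Qed.

Lemma at_levelP (a : 'I_d -> R) k : (forall i, 0 <= a i) ->
  0 < \sum_i a i ->
  at_level v (\sum_i a i *: v i) k <-> k%:R - 1 < \sum_i a i <= k%:R.
Proof.
move=> a0 s0; split=> [[b [_ _ /comb_inj ab]]|]; last by exists a.
by under eq_bigr do rewrite -ab.
Qed.

Lemma lev_comb (a : 'I_d -> R) k : (forall i, 0 <= a i) ->
  0 < \sum_i a i -> k%:R - 1 < \sum_i a i <= k%:R ->
  lev v (\sum_i a i *: v i) = k.
Proof.
move=> a0 s0 ak; apply: xget_unique => [|l]; first exact/at_levelP.
by move/(at_levelP _ a0 s0) => al; exact: level_unique al ak.
Qed.


(** * Reduced lattice points and the sets T_k *)

Definition reduced_points k : set 'rV[R]_n :=
  [set z | Zlattice z /\ exists2 a, reduced k a & z = \sum_i a i *: v i].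

Lemma reduced_points_unique k l z y x :
  reduced_points k z -> reduced_points l y ->
  translated_cone v z k x -> translated_cone v y l x -> k = l /\ z = y.
Proof.
move=> [_ [a ra ->]] [_ [b rb ->]] [_ /coneZP[w w0 ->] <-].
move=> [_ /coneZP[u u0 ->]]; rewrite -!big_split /=.
under eq_bigr do rewrite -scalerDl; under [RHS]eq_bigr do rewrite -scalerDl.
move=> /comb_inj/fsym/(reduced_unique ra rb w0 u0)[-> ab]; split=> //.
by apply: eq_bigr => i _; rewrite ab.
Qed.

Hypothesis d_gt0 : (0 < d)%N.

Lemma sum_pos_gt0 (a : 'I_d -> R) : (forall i, 0 < a i) -> 0 < \sum_i a i.
Proof.
move=> a0; rewrite (bigD1 (Ordinal d_gt0)) //= ltr_pwDl // sumr_ge0 // => i _.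
exact: ltW.
Qed.

Lemma reduced_points_level k z : reduced_points k z -> at_level v z k.
Proof.
move=> [_ [a [a0 ak _] ->]]; exists a; split=> // [i|]; first exact: ltW.
exact: sum_pos_gt0.
Qed.

Lemma lev_reduced_points k z : reduced_points k z -> lev v z = k.
Proof.
move=> [_ [a [a0 ak _] ->]]; apply: lev_comb => // [i|]; first exact: ltW.
exact: sum_pos_gt0.
Qed.

Hypothesis vZ : forall i, Zlattice (v i).

Lemma Zlattice_comb (w : 'I_d -> nat) : Zlattice (\sum_i (w i)%:R *: v i).
Proof.
apply/mxOverP => r c; rewrite summxE; apply: rpred_sum => i _.
by rewrite mxE rpredM ?rpred_nat //; exact: (mxOverP (vZ i)).
Qed.

Lemma reduced_points_cover (a : 'I_d -> R) : (forall i, 0 < a i) ->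
  Zlattice (\sum_i a i *: v i) ->
  exists k z, [/\ (0 < k <= d)%N, reduced_points k z
                & translated_cone v z k (\sum_i a i *: v i)].
Proof.
move=> a0 aZ; have [k [w [kd w0 rw]]] := reduced_exists d_gt0 a0.
have zE : \sum_i (a i - (w i)%:R) *: v i =
    \sum_i a i *: v i - \sum_i (w i)%:R *: v i.
  by rewrite -sumrB; apply: eq_bigr => i _; rewrite scalerBl.
exists k, (\sum_i (a i - (w i)%:R) *: v i); split=> //.
  split; last by exists (fun i => a i - (w i)%:R).
  rewrite zE; apply/mxOverP => r c; rewrite 2!mxE.
  by rewrite rpredB // ?(mxOverP aZ) ?(mxOverP (Zlattice_comb w)).
exists (\sum_i (w i)%:R *: v i); last by rewrite zE subrK.
by apply/coneZP; exists w.
Qed.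

(** Passing from [z] to [x] raises the coordinate sum by the natural number [\sum_i w i]; at equal
    levels this is below 1, hence 0. *)
Lemma translated_cone_level k l z x : reduced_points l z -> at_level v x k ->
  translated_cone v z l x -> (l <= k)%N /\ (l = k -> z = x).
Proof.
move=> [zZ [a ra zE]] [b [b0 s0 xE bk]] [_ /coneZP[w w0 ->]] xw.
have /comb_inj ab : \sum_i (a i + (w i)%:R) *: v i = \sum_i b i *: v i.
  rewrite -xE -xw zE -big_split /=; apply: eq_bigr => i _.
  by rewrite scalerDl.
have sE : \sum_i b i = \sum_i a i + (\sum_i w i)%:R.
  by rewrite natr_sum -big_split /=; apply: eq_bigr => i _; rewrite ab.
case: ra => _ /andP[a1 a2] _; case/andP: bk => b1 b2.
split; first by rewrite -(@ltr_natD1 R); have := ler0n R (\sum_i w i); lra.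
move=> lk; subst l.
have /eqP : (\sum_i w i = 0)%N.
  by apply/eqP; rewrite -leqn0 -(@ltr_natD1 R); lra.
rewrite sum_nat_eq0 => /forallP w00; rewrite -xw big1 ?addr0 // => i _.
by rewrite (eqP (w00 i)) scale0r.
Qed.

(** Strong induction. A point of T_k lies in the cone of some reduced [y] of level [l <= k]; [l < k]
    would have removed it, so it is [y]. A reduced point lies in its own cone, hence by uniqueness
    in no earlier one. *)
Lemma Tset_reduced_points k : (0 < k <= d)%N -> Tset v k = reduced_points k.
Proof.
have [m km] := ubnP k; elim: m => // m IH in k km *.
move=> /andP[k0 kd]; rewrite TsetE predeqE => z; split.
  move=> [[zZ [a [a0 _ zE]] zk] zn].
  rewrite zE in zZ; have [l [y [ld ry]]] := reduced_points_cover a0 zZ.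
  rewrite -zE => zy; have [lk yz] := translated_cone_level ry zk zy.
  have [{}lk|kl] := ltnP l k; last first.
    have lkE : l = k by apply/eqP; rewrite eqn_leq lk.
    by rewrite -(yz lkE) -lkE.
  case: zn; exists l => /=; first by case/andP: ld => ->.
  by exists y => //; rewrite IH // (leq_trans lk).
move=> rz; split.
  have zk := reduced_points_level rz.
  case: rz => zZ [a [a0 /andP[_ ak] _] zE]; split=> //.
  by exists a; split=> //; rewrite (le_trans ak) ?ler_nat.
move=> [l /= /andP[l0 lk] [y yl zy]].
rewrite IH ?(leq_trans lk) ?l0 ?(leq_trans (ltnW lk)) // in yl.
have zz : translated_cone v z k z.
  by exists 0; rewrite ?addr0 //; exists (fun=> 0%N); rewrite big1.
by have [kl _] := reduced_points_unique rz yl zz zy; rewrite kl ltnn in lk.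
Qed.

Lemma atomicP z : atomic v z <->
  exists2 k, (0 < k <= d)%N & reduced_points k z.
Proof.
by split=> -[k kd zk]; exists k => //; move: zk; rewrite Tset_reduced_points.
Qed.

End FreeGenerators.

Theorem theorem1p4 (R : realType) (n d : nat) (v : 'I_d -> 'rV[R]_n)
    (d_gt0 : (0 < d)%N) (le_dn : (d <= n)%N)
    (vZ : forall i, Zlattice (v i))
    (v_free : free [tuple v i | i < d]) :
  relint (coneR v) `&` Zlattice =
    \bigcup_(z in atomic v) translated_cone v z (lev v z) /\
  trivIset (atomic v) (fun z => translated_cone v z (lev v z)).
Proof.
split.
  rewrite predeqE => x; split.
    move=> [/(relint_coneRP v_free)[a a0 xE]]; rewrite xE => xZ.
    have [k [z [kd rz xz]]] := reduced_points_cover d_gt0 vZ a0 xZ.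
    exists z; first by apply/atomicP => //; exists k.
    by rewrite (lev_reduced_points v_free d_gt0 rz).
  move=> [z /(atomicP v_free d_gt0 vZ)[k kd rz]].
  rewrite (lev_reduced_points v_free d_gt0 rz) => -[_ /coneZP[w w0 ->] <-].
  case: rz => zZ [a [a0 _ _] zE]; split; last first.
    apply/mxOverP => r c; rewrite mxE.
    by rewrite rpredD // ?(mxOverP zZ) ?(mxOverP (Zlattice_comb vZ w)).
  (* Adding natural multiples of generators keeps every coordinate positive. *)
  apply/(relint_coneRP v_free); exists (fun i => a i + (w i)%:R).
    by move=> i; rewrite ltr_pwDl.
  by rewrite zE -big_split; apply: eq_bigr => i _; rewrite scalerDl.
move=> z y /(atomicP v_free d_gt0 vZ)[k _ rz] /(atomicP v_free d_gt0 vZ)[l _ ry].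
rewrite (lev_reduced_points v_free d_gt0 rz) (lev_reduced_points v_free d_gt0 ry).
by move=> [x [xz xy]]; have [] := reduced_points_unique v_free rz ry xz xy.
Qed.
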